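(* Let $P(\alpha,\beta,\gamma)$ be a point in the plane of the triangle $ABC$, and let $A',B',C'$ be its projections on the sides $BC$, $CA$, $AB$ respectively. Let $k\in\mathbb{R}^*$ and consider the points $A'',B'',C''$ such that $$\overrightarrow{PA''}=k\,\overrightarrow{PA'},\qquad \overrightarrow{PB''}=k\,\overrightarrow{PB'},\qquad \overrightarrow{PC''}=k\,\overrightarrow{PC'}.$$ Suppose also that $AA'$, $BB'$, $CC'$ are concurrent. Then the lines $AA''$, $BB''$, $CC''$ are concurrent if and only if the following two conditions are satisfied simultaneously: $$\alpha\beta c\left(\frac{\beta}{b}\cos A-\frac{\alpha}{a}\cos B\right)+\beta\gamma a\left(\frac{\gamma}{c}\cos B-\frac{\beta}{b}\cos C\right)+\gamma\alpha b\left(\frac{\alpha}{a}\cos C-\frac{\gamma}{c}\cos A\right)=0$$ and $$\frac{\alpha^2}{a^2}\cos A\left(\frac{\gamma}{c}\cos B-\frac{\beta}{b}\cos C\right)+\frac{\beta^2}{b^2}\cos B\left(\frac{\alpha}{a}\cos C-\frac{\gamma}{c}\cos A\right)+\frac{\gamma^2}{c^2}\cos C\left(\frac{\beta}{b}\cos A-\frac{\alpha}{a}\cos B\right)=0.$$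
   Context: Here $a=BC$, $b=CA$, $c=AB$ are the side lengths of the triangle $ABC$, and $A,B,C$ inside the cosines denote its angles at the corresponding vertices. Projections are orthogonal projections (onto the lines containing the sides). $\mathbb{R}^*$ is the set of nonzero real numbers. $P(\alpha,\beta,\gamma)$ means that $P$ has barycentric coordinates $(\alpha,\beta,\gamma)$ with respect to $ABC$, normalized by $\alpha+\beta+\gamma=1$, that is, $\vec r_P=\alpha\,\vec r_A+\beta\,\vec r_B+\gamma\,\vec r_C$, where $\vec r_X$ denotes the position vector of the point $X$.
   Formalization: The case k = 1 is excluded, since there A''=A', B''=B', C''=C' and the claim fails; ''concurrent'' is read projectively (three parallel lines count), and a line AA'' with A''=A imposes no condition. *)

(* Defs.v *)
From mathcomp Require Import all_boot all_order all_algebra.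
From mathcomp Require Import all_classical all_reals all_analysis.

Set Implicit Arguments.
Unset Strict Implicit.
Unset Printing Implicit Defensive.

Import Order.TTheory GRing.Theory Num.Theory.

Local Open Scope ring_scope.

Section PlaneGeometry.
Variable R : realType.

(* Points of the Euclidean plane are identified with their position vectors. *)
Implicit Types u v X Y Z U V : 'rV[R]_2.

Definition dot u v : R := (u *m v^T) 0 0.

(* Not the norm `|u| of the library, which is the sup norm on 'rV[R]_2. *)
Definition enorm u : R := Num.sqrt (dot u u).

Definition dist X Y : R := enorm (Y - X).

(* The (unoriented) angle YXZ at the vertex X, a number in [0, pi]. *)
Definition angle X Y Z : R :=
  acos (dot (Y - X) (Z - X) / (enorm (Y - X) * enorm (Z - X))).

Definition parallel u v : Prop := u 0 0 * v 0 1 = u 0 1 * v 0 0.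

(* For U <> V this says that X lies on the line UV. *)
Definition collinear U V X : Prop := parallel (V - U) (X - U).

Definition triangle X Y Z : Prop := ~ collinear X Y Z.

Definition is_projection X U V Y : Prop :=
  collinear U V Y /\ dot (Y - X) (V - U) = 0.

(* Concurrency of the lines U1V1, U2V2, U3V3 in the projective sense usual with
   barycentric coordinates: a common point, possibly at infinity.  If Ui = Vi,
   the line UiVi is undetermined and imposes no condition. *)
Definition concurrent U1 V1 U2 V2 U3 V3 : Prop :=
  (exists X, [/\ collinear U1 V1 X, collinear U2 V2 X & collinear U3 V3 X])
  \/ [/\ parallel (V1 - U1) (V2 - U2), parallel (V2 - U2) (V3 - U3)
       & parallel (V3 - U3) (V1 - U1)].

End PlaneGeometry.

(* Main.v *)
Require Import Defs.
From mathcomp Require Import all_boot all_order all_algebra ring lra.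
From mathcomp Require Import all_classical all_reals all_analysis.

Import Order.TTheory GRing.Theory Num.Theory.

Local Open Scope ring_scope.

(* Put x = alpha/a, y = beta/b, z = gamma/c.  For k <> 0, Ceva's theorem in
   barycentric coordinates turns the concurrency of the cevians through the
   points A'', B'', C'' into
     (y + k x cos C)(z + k y cos A)(x + k z cos B)
       = (z + k x cos B)(x + k y cos C)(y + k z cos A).
   The terms of degree 0 and 3 in k cancel, and dividing by k leaves an affine
   condition E1 = k abc E2, where E1 and E2 are the two expressions of the
   theorem.  The hypothesis is the case k = 1; as k <> 1, both conditions hold
   if and only if E1 = E2 = 0. *)

Section Plane.
Variable R : realType.
Local Set Implicit Arguments.
Local Unset Strict Implicit.
Implicit Types (u v w U V X Y Z A B C P Q : 'rV[R]_2).

(** * Dot products, cross products and angles in coordinates *)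

Definition cross u v : R := u 0 0 * v 0 1 - u 0 1 * v 0 0.

Lemma rV2P u v : u 0 0 = v 0 0 -> u 0 1 = v 0 1 -> u = v.
Proof.
move=> h0 h1; apply/rowP => -[[|[|//]] ltn_i].
  by rewrite (_ : Ordinal _ = 0) //; apply/val_inj.
by rewrite (_ : Ordinal _ = 1) //; apply/val_inj.
Qed.

Lemma dotE u v : dot u v = u 0 0 * v 0 0 + u 0 1 * v 0 1.
Proof.
rewrite /dot mxE !big_ord_recl big_ord0 !mxE addr0.
by rewrite (_ : lift _ _ = 1) //; apply/val_inj.
Qed.

Lemma enorm_sqr u : enorm u ^+ 2 = dot u u.
Proof. by rewrite sqr_sqrtr // dotE addr_ge0 // -expr2 sqr_ge0. Qed.

Lemma dot_eq0 u : (dot u u == 0) = (u == 0).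
Proof.
apply/eqP/eqP => [|->]; last by rewrite dotE !mxE mulr0 addr0.
rewrite dotE -!expr2 => /eqP; rewrite paddr_eq0 ?sqr_ge0 // !sqrf_eq0.
by move=> /andP[/eqP e0 /eqP e1]; apply: rV2P; rewrite mxE.
Qed.

Lemma enorm_eq0 u : (enorm u == 0) = (u == 0).
Proof. by rewrite -sqrf_eq0 enorm_sqr dot_eq0. Qed.

(** Lagrange's identity: the difference of the two sides is the square of [cross u v]. *)
Lemma cauchy_schwarz u v : dot u v ^+ 2 <= (enorm u * enorm v) ^+ 2.
Proof.
rewrite exprMn !enorm_sqr !dotE -subr_ge0.
rewrite (_ : _ - _ = cross u v ^+ 2) ?sqr_ge0 // /cross; ring.
Qed.

Lemma cos_angle X Y Z : cos (angle X Y Z) =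
  dot (Y - X) (Z - X) / (enorm (Y - X) * enorm (Z - X)).
Proof.
rewrite acosK // in_itv /= -ler_norml.
move: (Y - X) (Z - X) => u v.
have n_ge0 : 0 <= enorm u * enorm v by rewrite mulr_ge0 ?sqrtr_ge0.
(* If a norm vanishes, division by zero makes the quotient 0, which still lies in the domain of
   [acos]. *)
have [->|n_neq0] := eqVneq (enorm u * enorm v) 0.
  by rewrite invr0 mulr0 normr0.
rewrite normrM normfV (ger0_norm n_ge0) ler_pdivrMr ?lt0r ?n_neq0 // mul1r.
by rewrite -ler_sqr ?nnegrE // real_normK ?num_real // cauchy_schwarz.
Qed.

Lemma dist_sqr X Y : dist X Y ^+ 2 = dot (Y - X) (Y - X).
Proof. exact: enorm_sqr. Qed.

Lemma distC X Y : dist X Y = dist Y X.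
Proof. by rewrite /dist /enorm !dotE !mxE; congr Num.sqrt; ring. Qed.

Lemma dist_eq0 X Y : (dist X Y == 0) = (X == Y).
Proof. by rewrite enorm_eq0 subr_eq0 eq_sym. Qed.

Lemma dotC u v : dot u v = dot v u.
Proof. by rewrite !dotE; ring. Qed.

Lemma angleC X Y Z : angle X Y Z = angle X Z Y.
Proof. by rewrite /angle dotC mulrC [in RHS]mulrC [enorm _ * _]mulrC. Qed.

Lemma dot_dist X Y Z : X != Y -> X != Z ->
  dot (Y - X) (Z - X) = dist X Y * dist X Z * cos (angle X Y Z).
Proof.
move=> XY XZ; rewrite cos_angle -!/(dist _ _) mulrC divfK //.
by rewrite mulf_neq0 ?dist_eq0.
Qed.

(** * Lines as linear equations, and their concurrency *)

Lemma collinearE U V X : collinear U V X <-> cross X (V - U) = cross U (V - U).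
Proof. by rewrite /collinear /parallel /cross !mxE; split=> h; lra. Qed.

Lemma parallelE u v : parallel u v <-> cross u v = 0.
Proof. by rewrite /parallel /cross; split=> h; lra. Qed.

(** In the plane, [d1], [d2], [d3] with weights [cross d2 d3], [cross d3 d1], [cross d1 d2] sum to
    zero. The second hypothesis is the same relation between the constants, so the third equation
    follows from the first two. *)
Lemma meet_three U1 d1 U2 d2 U3 d3 : cross d1 d2 != 0 ->
  cross U1 d1 * cross d2 d3 + cross U2 d2 * cross d3 d1
  + cross U3 d3 * cross d1 d2 = 0 ->
  exists X, [/\ cross X d1 = cross U1 d1, cross X d2 = cross U2 d2
              & cross X d3 = cross U3 d3].
Proof.
move=> n0 e.
(* The point of the first line at which the second equation holds. *)
exists (U1 + (cross (U2 - U1) d2 / cross d1 d2) *: d1).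
have e3 : cross U3 d3 =
    - (cross U1 d1 * cross d2 d3 + cross U2 d2 * cross d3 d1) / cross d1 d2.
  by apply: (mulIf n0); rewrite divfK //; lra.
rewrite e3; move: n0; rewrite /cross !mxE => n0.
by split; field.
Qed.

(* The left-hand side is the determinant of the coefficients of the lines
   [cross X (Vi - Ui) = cross Ui (Vi - Ui)].  It also vanishes for parallel
   lines and when some [Ui = Vi], as [concurrent] requires. *)
Lemma concurrentP U1 V1 U2 V2 U3 V3 :
  concurrent U1 V1 U2 V2 U3 V3 <->
  cross U1 (V1 - U1) * cross (V2 - U2) (V3 - U3)
  + cross U2 (V2 - U2) * cross (V3 - U3) (V1 - U1)
  + cross U3 (V3 - U3) * cross (V1 - U1) (V2 - U2) = 0.
Proof.
split=> [[[X [/collinearE h1 /collinearE h2 /collinearE h3]]|]|e].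
- by rewrite -h1 -h2 -h3 /cross; ring.
- case=> /parallelE h1 /parallelE h2 /parallelE h3.
  by rewrite h1 h2 h3 !mulr0 !addr0.
have [e12|n12] := eqVneq (cross (V1 - U1) (V2 - U2)) 0; last first.
  have [X [h1 h2 h3]] := meet_three n12 e.
  by left; exists X; split; apply/collinearE.
have [e23|n23] := eqVneq (cross (V2 - U2) (V3 - U3)) 0; last first.
  have [|X [h2 h3 h1]] := @meet_three U2 _ U3 _ U1 (V1 - U1) n23; first by lra.
  by left; exists X; split; apply/collinearE.
have [e31|n31] := eqVneq (cross (V3 - U3) (V1 - U1)) 0; last first.
  have [|X [h3 h1 h2]] := @meet_three U3 _ U1 _ U2 (V2 - U2) n31; first by lra.
  by left; exists X; split; apply/collinearE.
by right; split; apply/parallelE.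
Qed.

(** * Uniqueness of projections, and Ceva's theorem *)

Lemma dot_cross_inj u v (e : 'rV[R]_2) :
  e != 0 -> dot u e = dot v e -> cross u e = cross v e -> u = v.
Proof.
rewrite -dot_eq0 => n0 eqD eqC.
(* [e] and its quarter turn form an orthogonal basis, in which [dot w e] and [cross w e] determine
   [w]. *)
have coord0 (w : 'rV[R]_2) :
    dot e e * w 0 0 = dot w e * e 0 0 + cross w e * e 0 1.
  by rewrite !dotE /cross; ring.
have coord1 (w : 'rV[R]_2) :
    dot e e * w 0 1 = dot w e * e 0 1 - cross w e * e 0 0.
  by rewrite !dotE /cross; ring.
by apply: rV2P; apply: (mulfI n0); rewrite ?coord0 ?coord1 eqD eqC.
Qed.

Lemma projection_unique P U V Q Q' : U != V ->
  is_projection P U V Q -> is_projection P U V Q' -> Q = Q'.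
Proof.
rewrite eq_sym -subr_eq0 => e0 [/collinearE c1 o1] [/collinearE c2 o2].
apply: (dot_cross_inj e0); last by rewrite c1 c2.
by move: o1 o2; rewrite !dotE !mxE => o1 o2; lra.
Qed.

(** The concurrency determinant is the difference of the two products times the square of twice the
    signed area of the triangle. Parallel cevians and [A1 = A] are covered as well. *)
Lemma ceva A B C A1 B1 C1 (uA vA wA uB vB wB uC vC wC : R) :
  triangle A B C ->
  uA + vA + wA = 1 -> uB + vB + wB = 1 -> uC + vC + wC = 1 ->
  A1 = uA *: A + vA *: B + wA *: C ->
  B1 = uB *: A + vB *: B + wB *: C ->
  C1 = uC *: A + vC *: B + wC *: C ->
  concurrent A A1 B B1 C C1 <-> vA * wB * uC = wA * uB * vC.
Proof.
move=> hABC sA sB sC -> -> ->; rewrite concurrentP.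
have D_neq0 : cross (B - A) (C - A) != 0 by apply/eqP => /parallelE.
(* Eliminating one coordinate per point turns the factorization into a polynomial identity. *)
have -> : uA = 1 - vA - wA by lra.
have -> : vB = 1 - uB - wB by lra.
have -> : wC = 1 - uC - vC by lra.
set lhs := (X in X = 0 <-> _).
have -> : lhs = cross (B - A) (C - A) ^+ 2 * (vA * wB * uC - wA * uB * vC).
  by rewrite /lhs /cross !mxE; ring.
split=> [/eqP|->]; last by rewrite subrr mulr0.
by rewrite mulf_eq0 expf_eq0 /= (negPf D_neq0) /= subr_eq0 => /eqP.
Qed.

(** * Barycentric coordinates of the dilated projections *)

Lemma triangle_neq A B C : triangle A B C -> [/\ A != B, B != C & C != A].
Proof.
move=> hABC; split; apply/eqP => e; apply: hABC;
  by rewrite /collinear /parallel e !mxE; ring.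
Qed.

(** This is a = b cos C + c cos B, divided by a. It ensures that the coordinates of the dilated
    points sum to 1. *)
Lemma dist_projection A B C : A != B -> B != C -> C != A ->
  dist C A / dist B C * cos (angle C A B)
  + dist A B / dist B C * cos (angle B C A) = 1.
Proof.
move=> AB BC CA.
have BC0 : dist B C != 0 by rewrite dist_eq0.
have CB : C != B by rewrite eq_sym.
have BA : B != A by rewrite eq_sym.
have : dist B C ^+ 2 = dist C A * dist C B * cos (angle C A B)
                       + dist B A * dist B C * cos (angle B A C).
  by rewrite dist_sqr -!dot_dist // !dotE !mxE; ring.
rewrite (distC C B) (distC B A) (angleC B) => e.
by apply: (mulfI (expf_neq0 2 BC0)); rewrite mulr1 [RHS]e; field.
Qed.

(** The projection onto BC is affine, fixes B and C, and sends A to the point with coordinates (0, b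
    cos C / a, c cos B / a). This gives [Q], and then S = (1 - k) P + k Q. *)
Lemma dilated_projection A B C P Q S (alpha beta gamma k : R) :
  A != B -> B != C -> C != A -> alpha + beta + gamma = 1 ->
  P = alpha *: A + beta *: B + gamma *: C ->
  is_projection P B C Q -> S - P = k *: (Q - P) ->
  S = ((1 - k) * alpha) *: A
      + (beta + k * alpha * (dist C A / dist B C * cos (angle C A B))) *: B
      + (gamma + k * alpha * (dist A B / dist B C * cos (angle B C A))) *: C.
Proof.
move=> AB BC CA sum1 eP projQ eS.
have BC0 : dist B C != 0 by rewrite dist_eq0.
have n0 : dot (C - B) (C - B) != 0 by rewrite -dist_sqr expf_neq0.
(* Dot products replace lengths and cosines, so that the foot is a rational expression in the
   coordinates of the vertices. *)
have -> : dist C A / dist B C * cos (angle C A B)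
          = dot (A - C) (B - C) / dot (C - B) (C - B).
  by rewrite dot_dist ?[C == B]eq_sym // -dist_sqr (distC C B); field.
have -> : dist A B / dist B C * cos (angle B C A)
          = dot (A - B) (C - B) / dot (C - B) (C - B).
  rewrite dot_dist ?[B == A]eq_sym // -dist_sqr (distC B A) (angleC B).
  by field.
have {projQ}eQ : Q =
    (beta + alpha * (dot (A - C) (B - C) / dot (C - B) (C - B))) *: B
    + (gamma + alpha * (dot (A - B) (C - B) / dot (C - B) (C - B))) *: C.
  apply: (projection_unique BC projQ); move: n0.
  rewrite eP; have -> : gamma = 1 - alpha - beta by lra.
  rewrite /is_projection /collinear /parallel !dotE !mxE => n0.
  by split; field.
have -> : S = P + k *: (Q - P) by rewrite -eS addrC subrK.
by rewrite eQ eP; apply: rV2P; rewrite !mxE; ring.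
Qed.

(** Stated for every nonzero [k], it applies both to the dilated points and, with [k = 1], to the
    projections. *)
Lemma concurrent_dilated A B C P A1 B1 C1 A2 B2 C2 (alpha beta gamma k : R) :
  triangle A B C -> alpha + beta + gamma = 1 ->
  P = alpha *: A + beta *: B + gamma *: C ->
  is_projection P B C A1 -> is_projection P C A B1 -> is_projection P A B C1 ->
  A2 - P = k *: (A1 - P) -> B2 - P = k *: (B1 - P) -> C2 - P = k *: (C1 - P) ->
  k != 0 ->
  let a := dist B C in let b := dist C A in let c := dist A B in
  let cA := cos (angle A B C) in
  let cB := cos (angle B C A) in
  let cC := cos (angle C A B) in
  concurrent A A2 B B2 C C2 <->
  (alpha * beta * c * (beta / b * cA - alpha / a * cB)
   + beta * gamma * a * (gamma / c * cB - beta / b * cC)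
   + gamma * alpha * b * (alpha / a * cC - gamma / c * cA))
  = k * (a * b * c) *
  (alpha ^+ 2 / a ^+ 2 * cA * (gamma / c * cB - beta / b * cC)
   + beta ^+ 2 / b ^+ 2 * cB * (alpha / a * cC - gamma / c * cA)
   + gamma ^+ 2 / c ^+ 2 * cC * (beta / b * cA - alpha / a * cB)).
Proof.
move=> hABC sum1 eP hA hB hC eA eB eC k0 a b c cA cB cC.
have [AB BC CA] := triangle_neq hABC.
have [a0 b0 c0] : [/\ a != 0, b != 0 & c != 0] by rewrite !dist_eq0.
have sum2 : beta + gamma + alpha = 1 by lra.
have sum3 : gamma + alpha + beta = 1 by lra.
(* The other two sides follow by cyclic relabelling; [rot] restores the order A, B, C of the
   summands. *)
have rot (X Y Z : 'rV[R]_2) : X + Y + Z = Z + X + Y by rewrite addrC addrA.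
have eA2 := dilated_projection AB BC CA sum1 eP hA eA.
have eP2 := etrans eP (esym (rot _ _ _)).
have eB2 := dilated_projection BC CA AB sum2 eP2 hB eB.
have eC2 := dilated_projection CA AB BC sum3 (etrans eP (rot _ _ _)) hC eC.
rewrite rot in eB2; rewrite -rot in eC2.
have := dist_projection AB BC CA.
have := dist_projection BC CA AB.
have := dist_projection CA AB BC.
move: eA2 eB2 eC2; rewrite -/a -/b -/c -/cA -/cB -/cC => eA2 eB2 eC2 pC pB pA.
rewrite (ceva hABC _ _ _ eA2 eB2 eC2); first 1 last.
- by have := congr1 ( *%R (k * alpha)) pA; lra.
- by have := congr1 ( *%R (k * beta)) pB; lra.
- by have := congr1 ( *%R (k * gamma)) pC; lra.
set E1 := (X in _ <-> X = _); set E2 := (X in _ <-> _ = _ * X).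
(* The two equations are equivalent because their defects differ by the factor [k]. *)
have eq_iff (p q r s : R) : p - q = k * (r - s) -> (p = q <-> r = s).
  move=> e; split=> h; apply/eqP; rewrite -subr_eq0.
    by move/eqP: e; rewrite h subrr eq_sym mulf_eq0 (negPf k0).
  by rewrite e h subrr mulr0.
apply: eq_iff; rewrite /E1 /E2; field.
by rewrite a0 b0 c0.
Qed.

End Plane.

Theorem theorem1 (R : realType) (A B C P A' B' C' A'' B'' C'' : 'rV[R]_2)
    (a b c tA tB tC alpha beta gamma k : R)
    (hABC : triangle A B C)
    (ha : a = dist B C) (hb : b = dist C A) (hc : c = dist A B)
    (htA : tA = angle A B C) (htB : tB = angle B C A) (htC : tC = angle C A B)
    (hsum : alpha + beta + gamma = 1)
    (hP : P = alpha *: A + beta *: B + gamma *: C)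
    (hA' : is_projection P B C A')
    (hB' : is_projection P C A B')
    (hC' : is_projection P A B C')
    (hk0 : k != 0) (hk1 : k != 1)
    (hA'' : A'' - P = k *: (A' - P))
    (hB'' : B'' - P = k *: (B' - P))
    (hC'' : C'' - P = k *: (C' - P))
    (hconc : concurrent A A' B B' C C') :
  concurrent A A'' B B'' C C'' <->
  (alpha * beta * c * (beta / b * cos tA - alpha / a * cos tB)
   + beta * gamma * a * (gamma / c * cos tB - beta / b * cos tC)
   + gamma * alpha * b * (alpha / a * cos tC - gamma / c * cos tA) = 0
   /\
   alpha ^+ 2 / a ^+ 2 * cos tA * (gamma / c * cos tB - beta / b * cos tC)
   + beta ^+ 2 / b ^+ 2 * cos tB * (alpha / a * cos tC - gamma / c * cos tA)
   + gamma ^+ 2 / c ^+ 2 * cos tC * (beta / b * cos tA - alpha / a * cos tB)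
   = 0).
Proof.
subst a b c tA tB tC.
have [AB BC CA] := triangle_neq hABC.
(* Subtracting the two equations leaves (1 - k) t E2 = 0; here t is the product of the side
   lengths. *)
have pencil (E1 E2 t : R) : t != 0 -> E1 = 1 * t * E2 ->
    E1 = k * t * E2 <-> E1 = 0 /\ E2 = 0.
  rewrite mul1r => t0 e; split=> [|[-> ->]]; last by rewrite mulr0.
  move/eqP; rewrite e -subr_eq0 -mulrA -{1}[t * E2]mul1r -mulrBl !mulf_eq0.
  rewrite subr_eq0 eq_sym (negPf hk1) (negPf t0) /= => /eqP ->.
  by rewrite mulr0.
apply: iff_trans.
  exact: (concurrent_dilated hABC hsum hP hA' hB' hC' hA'' hB'' hC'' hk0).
apply: pencil; first by rewrite !mulf_neq0 ?dist_eq0.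
(* The projections are their own dilations of ratio 1, so [hconc] yields the equation for
   [k = 1]. *)
have dilate1 (X Y : 'rV[R]_2) : X - Y = 1 *: (X - Y) by rewrite scale1r.
apply/(concurrent_dilated hABC hsum hP hA' hB' hC' (dilate1 _ _)
         (dilate1 _ _) (dilate1 _ _) (oner_neq0 R)); exact: hconc.
Qed.
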